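(* Let $\mathcal{A}$ be a Hopf algebra with invertible antipode over a field. For any right group-like projection $P\in\mathcal{A}$ the associated left coideal subalgebras $\mathcal{N}_P$, $\mathcal{N}_P^l$ and $\mathcal{N}_P^r$ are finite-dimensional.
   Context: $(\mathcal{A},\Delta,S,\varepsilon)$ is a Hopf algebra over an arbitrary field with invertible antipode $S$ and unit $1$. A projection is an idempotent. A right group-like projection is a non-zero projection $P\in\mathcal{A}$ with $\Delta(P)(1\otimes P)=P\otimes P=(1\otimes P)\Delta(P)$. A left coideal subalgebra is a unital subalgebra $\mathcal{N}\subset\mathcal{A}$ with $\Delta(\mathcal{N})\subset\mathcal{A}\otimes\mathcal{N}$. Define $\mathcal{N}^l_P=\{x\in\mathcal{A}:(1\otimes P)\Delta(x)=x\otimes P\}$, $\mathcal{N}^r_P=\{x\in\mathcal{A}:\Delta(x)(1\otimes P)=x\otimes P\}$, $\mathcal{N}_P=\mathcal{N}^l_P\cap\mathcal{N}^r_P$. *)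

(* Defs.v *)
From HB Require Import structures.
From mathcomp Require Import all_boot all_order all_algebra.
From mathcomp Require Import generic_quotient.
From mathcomp Require Import boolp.

Set Implicit Arguments.
Unset Strict Implicit.
Unset Printing Implicit Defensive.

Import GRing.Theory.
Local Open Scope ring_scope.
Local Open Scope quotient_scope.

(* The tensor product of two vector spaces of arbitrary dimension, as the set
   of formal sums of pairs (scalars are absorbed in the left factor) modulo
   the relation of being identified by every bilinear map. The lemmas
   [tensor_lift_pure] and [tensor_lift_uniq] are its universal property. *)

Section TensorCarrier.
Variables (K : fieldType) (U V : lmodType K).

Definition formal_sum_eval (W : lmodType K) (f : U -> V -> W)
    (s : seq (U * V)) : W := \sum_(p <- s) f p.1 p.2.

Definition tensor_eqv (s t : seq (U * V)) : bool :=
  `[< forall (W : lmodType K) (f : {bilinear U -> V -> W}),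
        formal_sum_eval f s = formal_sum_eval f t >].

Lemma tensor_eqv_refl : reflexive tensor_eqv.
Proof. by move=> s; apply/asboolP. Qed.

Lemma tensor_eqv_sym : symmetric tensor_eqv.
Proof. by move=> s t; apply/asboolP/asboolP => h W f; rewrite h. Qed.

Lemma tensor_eqv_trans : transitive tensor_eqv.
Proof.
move=> s r t /asboolP h1 /asboolP h2; apply/asboolP => W f.
by rewrite h1 h2.
Qed.

Definition tensor_equiv :=
  EquivRel tensor_eqv tensor_eqv_refl tensor_eqv_sym tensor_eqv_trans.

Definition tensor := {eq_quot tensor_equiv}.

HB.instance Definition _ := Choice.on tensor.

Definition tensor_class (s : seq (U * V)) : tensor := \pi s.

Lemma tensor_classP s t :
  (forall (W : lmodType K) (f : {bilinear U -> V -> W}),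
     formal_sum_eval f s = formal_sum_eval f t) ->
  tensor_class s = tensor_class t.
Proof. by move=> h; apply/eqquotP/asboolP. Qed.

Lemma tensor_class_repr (t : tensor) : tensor_class (repr t) = t.
Proof. exact: reprK. Qed.

Lemma repr_tensor_class (s : seq (U * V)) (W : lmodType K)
  (f : {bilinear U -> V -> W}) :
  formal_sum_eval f (repr (tensor_class s)) = formal_sum_eval f s.
Proof.
have : tensor_class (repr (tensor_class s)) = tensor_class s by exact: reprK.
by move/eqquotP/asboolP; apply.
Qed.

Definition tensor_zero : tensor := tensor_class [::].
Definition tensor_add (s t : tensor) : tensor :=
  tensor_class (repr s ++ repr t).
Definition tensor_scale (k : K) (t : tensor) : tensor :=
  tensor_class [seq (k *: p.1, p.2) | p <- repr t].
Definition tensor_opp (t : tensor) : tensor := tensor_scale (-1) t.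

Lemma eval_cat (W : lmodType K) (f : U -> V -> W) s t :
  formal_sum_eval f (s ++ t) = formal_sum_eval f s + formal_sum_eval f t.
Proof. exact: big_cat. Qed.

Lemma eval_scale (W : lmodType K) (f : {bilinear U -> V -> W}) k s :
  formal_sum_eval f [seq (k *: p.1, p.2) | p <- s] = k *: formal_sum_eval f s.
Proof.
rewrite /formal_sum_eval big_map scaler_sumr; apply: eq_bigr => p _ /=.
by rewrite linearZl_LR.
Qed.

Lemma tensor_addA : associative tensor_add.
Proof.
move=> x y z; apply: tensor_classP => W f.
by rewrite !(eval_cat, repr_tensor_class) addrA.
Qed.

Lemma tensor_addC : commutative tensor_add.
Proof.
by move=> x y; apply: tensor_classP => W f; rewrite !eval_cat addrC.
Qed.

Lemma tensor_add0 : left_id tensor_zero tensor_add.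
Proof.
move=> x; rewrite -[RHS]tensor_class_repr; apply: tensor_classP => W f.
by rewrite eval_cat repr_tensor_class /formal_sum_eval big_nil add0r.
Qed.

Lemma tensor_addN : left_inverse tensor_zero tensor_opp tensor_add.
Proof.
move=> x; apply: tensor_classP => W f.
rewrite eval_cat repr_tensor_class eval_scale scaleN1r addNr.
by rewrite /formal_sum_eval big_nil.
Qed.

HB.instance Definition _ := GRing.isZmodule.Build tensor
  tensor_addA tensor_addC tensor_add0 tensor_addN.

Lemma tensor_scaleA a b v :
  tensor_scale a (tensor_scale b v) = tensor_scale (a * b) v.
Proof.
apply: tensor_classP => W f.
by rewrite !(eval_scale, repr_tensor_class) scalerA.
Qed.

Lemma tensor_scale1 : left_id 1 tensor_scale.
Proof.
move=> x; rewrite -[RHS]tensor_class_repr; apply: tensor_classP => W f.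
by rewrite eval_scale scale1r.
Qed.

Lemma tensor_scaleDr : right_distributive tensor_scale +%R.
Proof.
move=> a x y; apply: tensor_classP => W f.
by rewrite !(eval_cat, eval_scale, repr_tensor_class) scalerDr.
Qed.

Lemma tensor_scaleDl v : {morph tensor_scale^~ v : a b / a + b}.
Proof.
move=> a b /=; apply: tensor_classP => W f.
by rewrite !(eval_cat, eval_scale, repr_tensor_class) scalerDl.
Qed.

HB.instance Definition _ := GRing.Zmodule_isLmodule.Build K tensor
  tensor_scaleA tensor_scale1 tensor_scaleDr tensor_scaleDl.

Definition tensor_pure (u : U) (v : V) : tensor := tensor_class [:: (u, v)].

Lemma tensor_pure_is_bilinear : bilinear_for *:%R *:%R tensor_pure.
Proof.
have eval1 (W : lmodType K) (f : {bilinear U -> V -> W}) p :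
  formal_sum_eval f [:: p] = f p.1 p.2 by rewrite /formal_sum_eval big_seq1.
split=> [v|u] k x y; apply: tensor_classP => W f;
  by rewrite !(eval_cat, repr_tensor_class, eval_scale) !eval1 /=
    ?linearPl ?linearPr.
Qed.

HB.instance Definition _ := bilinear_isBilinear.Build K U V tensor
  *:%R *:%R tensor_pure tensor_pure_is_bilinear.

Definition tensor_lift (W : lmodType K) (f : {bilinear U -> V -> W})
    (t : tensor) : W := formal_sum_eval f (repr t).

Lemma tensor_lift_is_linear (W : lmodType K) (f : {bilinear U -> V -> W}) :
  linear (tensor_lift f).
Proof.
by move=> k x y; rewrite /tensor_lift !(repr_tensor_class, eval_cat, eval_scale).
Qed.

HB.instance Definition _ (W : lmodType K) (f : {bilinear U -> V -> W}) :=
  GRing.isLinear.Build K tensor W *:%R (tensor_lift f)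
    (tensor_lift_is_linear f).

Lemma tensor_lift_pure (W : lmodType K) (f : {bilinear U -> V -> W}) u v :
  tensor_lift f (tensor_pure u v) = f u v.
Proof. by rewrite /tensor_lift repr_tensor_class /formal_sum_eval big_seq1. Qed.

Lemma tensor_sumP (t : tensor) :
  exists s : seq (U * V), t = \sum_(p <- s) tensor_pure p.1 p.2.
Proof.
exists (repr t); rewrite -[LHS]tensor_class_repr.
elim: (repr t) => [|[u v] s IHs]; first by rewrite big_nil.
rewrite big_cons -IHs; apply: tensor_classP => W f.
by rewrite eval_cat !repr_tensor_class -eval_cat.
Qed.

Lemma tensor_lift_uniq (W : lmodType K) (f g : {linear tensor -> W}) :
  (forall u v, f (tensor_pure u v) = g (tensor_pure u v)) -> f =1 g.
Proof.
move=> fg t; have [s ->] := tensor_sumP t.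
by rewrite !raddf_sum; apply: eq_bigr => p _; apply: fg.
Qed.

End TensorCarrier.

Notation "u \ot v" := (tensor_pure u v)
  (at level 38, left associativity) : ring_scope.

Section PureTheory.
Variables (K : fieldType) (U V : lmodType K).

Lemma tensor_purePl k (x y : U) (v : V) :
  (k *: x + y) \ot v = k *: (x \ot v) + y \ot v.
Proof. exact: (tensor_pure_is_bilinear U V).1. Qed.

Lemma tensor_purePr k (u : U) (x y : V) :
  u \ot (k *: x + y) = k *: (u \ot x) + u \ot y.
Proof. exact: (tensor_pure_is_bilinear U V).2. Qed.

End PureTheory.

Section TensorMap.
Variables (K : fieldType) (U V U' V' : lmodType K).
Variables (f : {linear U -> U'}) (g : {linear V -> V'}).

Definition tensor_map_pure (u : U) (v : V) : tensor U' V' := f u \ot g v.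

Lemma tensor_map_pure_is_bilinear : bilinear_for *:%R *:%R tensor_map_pure.
Proof.
by split=> [v|u] k x y; rewrite /tensor_map_pure linearP ?tensor_purePl ?tensor_purePr.
Qed.

HB.instance Definition _ := bilinear_isBilinear.Build K U V (tensor U' V')
  *:%R *:%R tensor_map_pure tensor_map_pure_is_bilinear.

Definition tensor_map : tensor U V -> tensor U' V' :=
  tensor_lift tensor_map_pure.

HB.instance Definition _ := GRing.Linear.on tensor_map.

Lemma tensor_map_pureE u v : tensor_map (u \ot v) = f u \ot g v.
Proof. exact: tensor_lift_pure. Qed.

End TensorMap.

Section TensorAssoc.
Variables (K : fieldType) (U V W : lmodType K).

Section Inner.
Variable w : W.
Definition assoc_inner (u : U) (v : V) : tensor U (tensor V W) :=
  u \ot (v \ot w).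

Lemma assoc_inner_is_bilinear : bilinear_for *:%R *:%R assoc_inner.
Proof.
by split=> [v|u] k x y; rewrite /assoc_inner ?tensor_purePl ?tensor_purePr.
Qed.

HB.instance Definition _ := bilinear_isBilinear.Build K U V
  (tensor U (tensor V W)) *:%R *:%R assoc_inner assoc_inner_is_bilinear.
End Inner.

Definition assoc_outer (t : tensor U V) (w : W) : tensor U (tensor V W) :=
  tensor_lift (assoc_inner w) t.

Lemma assoc_outer_is_bilinear : bilinear_for *:%R *:%R assoc_outer.
Proof.
split=> [w|t] k x y; rewrite /assoc_outer; first by rewrite linearP.
have [s ->] := tensor_sumP t; rewrite !raddf_sum /= scaler_sumr -big_split /=.
apply: eq_bigr => p _; rewrite !tensor_lift_pure /= /assoc_inner.
by rewrite !tensor_purePr.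
Qed.

HB.instance Definition _ := bilinear_isBilinear.Build K (tensor U V) W
  (tensor U (tensor V W)) *:%R *:%R assoc_outer assoc_outer_is_bilinear.

Definition tensor_assoc : tensor (tensor U V) W -> tensor U (tensor V W) :=
  tensor_lift assoc_outer.

HB.instance Definition _ := GRing.Linear.on tensor_assoc.

Lemma tensor_assocE u v w : tensor_assoc (u \ot v \ot w) = u \ot (v \ot w).
Proof. by rewrite /tensor_assoc tensor_lift_pure [LHS]tensor_lift_pure. Qed.

End TensorAssoc.

(* The product of [tensor A B] is [(a \ot b) * (c \ot d) = (a * c) \ot (b * d)].
   Only a possibly trivial ring structure is declared: [1 \ot 1 != 0] holds
   but is not needed. *)
Section TensorRing.
Variables (K : fieldType) (A B : algType K).

Section Inner.
Variables (a : A) (b : B).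
Definition tmul_inner (c : A) (d : B) : tensor A B := (a * c) \ot (b * d).

Lemma tmul_inner_is_bilinear : bilinear_for *:%R *:%R tmul_inner.
Proof.
split=> [v|u] k x y; rewrite /tmul_inner mulrDr -scalerAr.
  by rewrite tensor_purePl.
by rewrite tensor_purePr.
Qed.

HB.instance Definition _ := bilinear_isBilinear.Build K A B (tensor A B)
  *:%R *:%R tmul_inner tmul_inner_is_bilinear.
End Inner.

Section Outer.
Variable t : tensor A B.
Definition tmul_outer (a : A) (b : B) : tensor A B :=
  tensor_lift (tmul_inner a b) t.

Lemma tmul_outer_is_bilinear : bilinear_for *:%R *:%R tmul_outer.
Proof.
split=> [v|u] k x y; rewrite /tmul_outer; have [s ->] := tensor_sumP t;
  rewrite !raddf_sum /= scaler_sumr -big_split /=; apply: eq_bigr => p _;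
  rewrite !tensor_lift_pure /= /tmul_inner mulrDl -scalerAl.
  by rewrite tensor_purePl.
by rewrite tensor_purePr.
Qed.

HB.instance Definition _ := bilinear_isBilinear.Build K A B (tensor A B)
  *:%R *:%R tmul_outer tmul_outer_is_bilinear.
End Outer.

Definition tensor_mul (s t : tensor A B) : tensor A B :=
  tensor_lift (tmul_outer t) s.

Definition tensor_one : tensor A B := 1 \ot 1.

Lemma tensor_mul_pure a b c d :
  tensor_mul (a \ot b) (c \ot d) = (a * c) \ot (b * d).
Proof. by rewrite /tensor_mul tensor_lift_pure [LHS]tensor_lift_pure. Qed.

Lemma tensor_mulDl : left_distributive tensor_mul +%R.
Proof. by move=> x y z; rewrite /tensor_mul linearD. Qed.

Lemma tensor_mulDr : right_distributive tensor_mul +%R.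
Proof.
move=> x y z; rewrite /tensor_mul; have [s ->] := tensor_sumP x.
rewrite !raddf_sum /= -big_split /=; apply: eq_bigr => p _.
by rewrite !tensor_lift_pure /= /tmul_outer linearD.
Qed.

Lemma tensor_mul_suml (I : Type) (r : seq I) (F : I -> tensor A B) y :
  tensor_mul (\sum_(i <- r) F i) y = \sum_(i <- r) tensor_mul (F i) y.
Proof. by rewrite /tensor_mul raddf_sum. Qed.

Lemma tensor_mul_sumr (I : Type) (r : seq I) (F : I -> tensor A B) x :
  tensor_mul x (\sum_(i <- r) F i) = \sum_(i <- r) tensor_mul x (F i).
Proof.
elim: r => [|i r IHr]; last by rewrite !big_cons tensor_mulDr IHr.
rewrite !big_nil; apply: (@addrI _ (tensor_mul x 0)).
by rewrite -tensor_mulDr !addr0.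
Qed.

Lemma tensor_mulA : associative tensor_mul.
Proof.
move=> x y z; have [r ->] := tensor_sumP x; have [s ->] := tensor_sumP y.
have [t ->] := tensor_sumP z.
rewrite !tensor_mul_suml; apply: eq_bigr => p _.
rewrite [in LHS]tensor_mul_sumr [tensor_mul _ (\sum_(q <- s) _)]tensor_mul_sumr.
rewrite tensor_mul_suml; apply: eq_bigr => q _.
rewrite !tensor_mul_sumr; apply: eq_bigr => w _.
by rewrite !tensor_mul_pure !mulrA.
Qed.

Lemma tensor_mul1x : left_id tensor_one tensor_mul.
Proof.
move=> x; have [r ->] := tensor_sumP x; rewrite tensor_mul_sumr.
by apply: eq_bigr => p _; rewrite tensor_mul_pure !mul1r.
Qed.

Lemma tensor_mulx1 : right_id tensor_one tensor_mul.
Proof.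
move=> x; have [r ->] := tensor_sumP x; rewrite tensor_mul_suml.
by apply: eq_bigr => p _; rewrite tensor_mul_pure !mulr1.
Qed.

HB.instance Definition _ := GRing.Zmodule_isPzRing.Build (tensor A B)
  tensor_mulA tensor_mul1x tensor_mulx1 tensor_mulDl tensor_mulDr.

Lemma tensor_mulE (a c : A) (b d : B) :
  (a \ot b) * (c \ot d) = (a * c) \ot (b * d).
Proof. exact: tensor_mul_pure. Qed.

Lemma tensor_oneE : 1 = 1 \ot 1 :> tensor A B.
Proof. by []. Qed.

End TensorRing.

Section MulTensor.
Variables (K : fieldType) (A : algType K).

Definition alg_mul (a b : A) : A := a * b.

Lemma alg_mul_is_bilinear : bilinear_for *:%R *:%R alg_mul.
Proof.
by split=> [v|u] k x y; rewrite /alg_mul ?mulrDl ?mulrDr -?scalerAl -?scalerAr.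
Qed.

HB.instance Definition _ := bilinear_isBilinear.Build K A A A
  *:%R *:%R alg_mul alg_mul_is_bilinear.

Definition mul_tensor : tensor A A -> A := tensor_lift alg_mul.

HB.instance Definition _ := GRing.Linear.on mul_tensor.

Lemma mul_tensor_pure a b : mul_tensor (a \ot b) = a * b.
Proof. exact: tensor_lift_pure. Qed.

End MulTensor.

(* The counit axioms are stated in [tensor K^o C] and [tensor C K^o], which
   are identified with [C] through [x |-> 1 \ot x] and [x |-> x \ot 1]. *)
HB.mixin Record Lmodule_isCoalgebra (K : fieldType) C of GRing.Lmodule K C := {
  comul : {linear C -> tensor C C};
  counit : {linear C -> K^o};
  comulA : forall x : C,
    tensor_assoc (tensor_map comul idfun (comul x)) =
    tensor_map idfun comul (comul x);
  counitl : forall x : C,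
    tensor_map counit idfun (comul x) = (1 : K^o) \ot x;
  counitr : forall x : C,
    tensor_map idfun counit (comul x) = x \ot (1 : K^o)
}.

#[short(type="coalgType")]
HB.structure Definition Coalgebra (K : fieldType) :=
  { C of Lmodule_isCoalgebra K C & GRing.Lmodule K C }.

HB.mixin Record isHopf (K : fieldType) A
    of GRing.Algebra K A & Coalgebra K A := {
  comul1 : comul (1 : A) = 1;
  comulM : forall x y : A, comul (x * y) = comul x * comul y;
  counit1 : counit (1 : A) = 1 :> K;
  counitM : forall x y : A, counit (x * y) = (counit x : K) * counit y :> K;
  antipode : {linear A -> A};
  antipodel : forall x : A,
    mul_tensor (tensor_map antipode idfun (comul x)) = (counit x : K)%:A;
  antipoder : forall x : A,
    mul_tensor (tensor_map idfun antipode (comul x)) = (counit x : K)%:A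
}.

#[short(type="hopfAlgType")]
HB.structure Definition HopfAlgebra (K : fieldType) :=
  { A of isHopf K A & GRing.Algebra K A & Coalgebra K A }.

Definition finite_dim (K : fieldType) (V : lmodType K) (N : {pred V}) : Prop :=
  exists (n : nat) (b : 'I_n -> V),
    forall x : V, x \in N <-> exists c : 'I_n -> K, x = \sum_i c i *: b i.

Section GroupLikeProjection.
Variables (K : fieldType) (A : hopfAlgType K).

Definition in_tensor_right (N : {pred A}) (t : tensor A A) : Prop :=
  exists s : seq (A * A),
    (forall p, p \in s -> p.2 \in N) /\ t = \sum_(p <- s) p.1 \ot p.2.

Definition left_coideal_subalgebra (N : {pred A}) : Prop :=
  GRing.subalg_closed N /\
  forall x, x \in N -> in_tensor_right N (comul x).

Definition right_grouplike_projection (P : A) : Prop :=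
  [/\ P != 0, P * P = P,
      comul P * (1 \ot P) = P \ot P & P \ot P = (1 \ot P) * comul P].

Definition Nl (P : A) : {pred A} :=
  [pred x | (1 \ot P) * comul x == x \ot P].

Definition Nr (P : A) : {pred A} :=
  [pred x | comul x * (1 \ot P) == x \ot P].

Definition Nlr (P : A) : {pred A} := [predI Nl P & Nr P].

End GroupLikeProjection.

(* Main.v *)
Require Import Defs.
From HB Require Import structures.
From mathcomp Require Import all_boot all_order all_algebra.
From mathcomp Require Import boolp classical_sets.

(** Write [x1 (x) x2] for the coproduct of [x], [S] for the antipode, [T] for
its inverse and [e] for the counit.

Finiteness of [Nl P]. For [x] in [Nl P] the defining relation says
[x1 (x) P x2 = x (x) P]. Applying [u (x) v |-> comul v * (T u (x) 1)] to it,
and using [x2 * T x1 = e(x)], gives the sliding relation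

  [P1 (x) P2 x = P1 T(x) (x) P2]        (lemma [Nl_slide]).

Write [comul P] as a finite sum of [a_i (x) p_i] in which the [a_i] have a dual
family of functionals [f_i] (lemma [dual_decomposition]). Slicing the sliding
relation by [f_i] shows that [p_i x] lies in the span of the [p_k], for every
[x]. On the other hand, if [f] is a functional with [f P = 1], the antipode
axiom gives [f(P1) S(P2) P3 = 1], that is, [\sum_i b_i p_i = 1] with
[b_i = f(a_i1) S(a_i2)]. Hence [x = \sum_i b_i (p_i x)] lies in the span of the
finitely many [b_i p_k], which do not depend on [x]
(lemma [finite_span_translates]).

For [Nr P] the same argument runs with left and right multiplication, and [S]
and [T], exchanged; this is why the central lemma is about an arbitrary
bilinear [h] with [h(x1, x2) = e(x)]. The relation [x2 * T x1 = e(x)] is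
obtained by applying [S] to it, so the antimultiplicativity of [S] is needed
([antipodeM]). [Nlr P] is a subspace of [Nl P].

The coideal property: each of the sets is the kernel of linear maps [L] which
satisfy [x1 (x) L x2 = 0] as soon as [L x = 0], by coassociativity
([defect_coideal]); a decomposition of [comul x] with a dual family on the left
then has all its right legs in the kernel ([right_legs]). *)

Set Implicit Arguments.
Unset Strict Implicit.
Unset Printing Implicit Defensive.

Import GRing.Theory.
Local Open Scope classical_set_scope.
Local Open Scope ring_scope.

(** * Functionals on spaces of arbitrary dimension *)

Section Separation.
Variables (K : fieldType) (U : lmodType K).

Definition subspace (W : set U) : Prop :=
  W 0 /\ forall k x y, W x -> W y -> W (k *: x + y).

Lemma subspaceZ W k x : subspace W -> W x -> W (k *: x).
Proof. by move=> [W0 WP] Wx; rewrite -[k *: x]addr0; apply: WP. Qed.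

Lemma subspaceB W x y : subspace W -> W x -> W y -> W (x - y).
Proof.
by move=> [W0 WP] Wx Wy; rewrite addrC -scaleN1r; apply: WP.
Qed.

(** By Zorn's lemma, a subspace maximal among those that contain [W] and avoid
[a]: by maximality, adding any [x] outside it captures [a], so that it is a
hyperplane complementary to the line of [a]. *)
Lemma maximal_avoiding_subspace (W : set U) (a : U) :
  subspace W -> ~ W a ->
  exists M : set U, [/\ subspace M, W `<=` M, ~ M a &
    forall x, exists k, M (x - k *: a)].
Proof.
move=> [W0 Wlin] nWa.
(* The union with [W] is there because the chain given to Zorn's lemma may be
   empty, and the empty set is not a subspace. *)
pose Q (M : set U) := subspace (M `|` W) /\ ~ (M `|` W) a.
have [F FQ Ftot|M [[sM nMa] Mmax]] := @Zorn_bigcup U Q.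
  split; last by move=> [[X FX Xa]|//]; have [_] := FQ X FX; apply; left.
  split=> [|k x y]; first by right.
  move=> [[X FX Xx]|Wx] [[Y FY Yy]|Wy]; last by right; apply: Wlin.
  - wlog : X Y FX FY Xx Yy / X `<=` Y => [wlg|XY].
      have [XY|YX] := Ftot X Y FX FY; first exact: (wlg X Y).
      by apply: (wlg X X) => //; apply: YX.
    have [[_ lin] _] := FQ Y FY.
    by move: (lin k x y (or_introl (XY _ Xx)) (or_introl Yy)) => [h|];
      [left; exists Y|right].
  - have [[_ lin] _] := FQ X FX.
    by move: (lin k x y (or_introl Xx) (or_intror Wy)) => [h|];
      [left; exists X|right].
  - have [[_ lin] _] := FQ Y FY.
    by move: (lin k x y (or_intror Wx) (or_introl Yy)) => [h|];
      [left; exists Y|right].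
exists (M `|` W); split=> //.
move=> x; have [Mx|nMx] := pselect ((M `|` W) x).
  by exists 0; rewrite scale0r subr0.
(* [X] is the span of the maximal subspace and [x]. *)
pose X y := exists m k, (M `|` W) m /\ y = m + k *: x.
have MX : M `|` W `<=` X.
  by move=> y My; exists y, 0; rewrite scale0r addr0.
have sX : subspace X.
  split; first by apply: MX; apply: sM.1.
  move=> k _ _ [m1 [k1 [Mm1 ->]]] [m2 [k2 [Mm2 ->]]].
  exists (k *: m1 + m2), (k * k1 + k2); split; first exact: sM.2.
  by rewrite scalerDr scalerDl scalerA addrACA.
have XW : X `|` W = X by apply: setUidl => y Wy; apply: MX; right.
have Xa : X a.
  apply: contrapT => nXa; apply: (Mmax X); last by rewrite /Q XW.
  split; first by move=> y My; apply: MX; left.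
  move=> /(_ x) h; apply: nMx; left; apply: h.
  by exists 0, 1; rewrite scale1r add0r; split=> //; exact: sM.1.
have [m [k [Mm aE]]] := Xa.
have k0 : k != 0.
  by apply/eqP => k0; apply: nMa; rewrite aE k0 scale0r addr0.
exists k^-1; rewrite aE scalerDr scalerA mulVf // scale1r opprD addrCA subrr.
rewrite addr0 -scalerN -[- m]add0r; apply: subspaceZ => //.
by apply: subspaceB => //; apply: sM.1.
Qed.

Lemma separating_functional (W : set U) (a : U) :
  subspace W -> ~ W a ->
  exists f : {linear U -> K^o}, f a = 1 /\ forall x, W x -> f x = 0.
Proof.
move=> sW nWa.
have [M [sM WM nMa /choice[f fP]]] := maximal_avoiding_subspace sW nWa.
have f_uniq x k : M (x - k *: a) -> f x = k.
  move=> Mk; apply/eqP; rewrite -subr_eq0; apply/eqP.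
  have := subspaceB sM Mk (fP x).
  rewrite opprB addrC addrA subrK -scalerBl => Mfk.
  have [//|fk0] := eqVneq (f x - k) 0.
  case: nMa; rewrite -[a]scale1r -(mulVf fk0) -scalerA; exact: subspaceZ.
have f_lin : linear (f : U -> K^o).
  move=> k x y; apply: f_uniq.
  have := sM.2 k _ _ (fP x) (fP y).
  by rewrite scalerBr scalerA addrACA -opprD -scalerDl.
pose g : {linear U -> K^o} := HB.pack (f : U -> K^o)
  (GRing.isLinear.Build K U K^o *:%R f f_lin).
exists g; split=> [|x Wx] /=; apply: f_uniq.
  by rewrite scale1r subrr; apply: sM.1.
by rewrite scale0r subr0; apply: WM.
Qed.

End Separation.

Section DualDecomposition.
Variables (K : fieldType) (U V : lmodType K).

Definition dual_family n (u : 'I_n -> U) (f : 'I_n -> {linear U -> K^o}) :=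
  forall i j, f i (u j) = (i == j)%:R.

(** A decomposition with the least number of terms works. Otherwise no
functional separates some [u i] from the other [u j], so [u i] is a combination
of them, and its term can be distributed over theirs. *)
Lemma dual_decomposition (t : tensor U V) :
  exists n (u : 'I_n -> U) (v : 'I_n -> V) (f : 'I_n -> {linear U -> K^o}),
    t = \sum_i u i \ot v i /\ dual_family u f.
Proof.
pose len n := `[< exists (u : 'I_n -> U) (v : 'I_n -> V),
                    t = \sum_i u i \ot v i >].
have ex_len : exists n, len n.
  have [s tE] := tensor_sumP t; exists (size s); apply/asboolP.
  exists (fun i => (tnth (in_tuple s) i).1), (fun i => (tnth (in_tuple s) i).2).
  by rewrite tE -(big_tuple _ _ (in_tuple s) xpredT (fun p => p.1 \ot p.2)).
have [n /asboolP[u [v tE]] n_min] := ex_minnP ex_len.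
exists n, u, v.
suff /fin_all_exists[f fP] : forall i, exists f : {linear U -> K^o},
    forall j, f (u j) = (i == j)%:R by exists f; split.
move=> i.
(* [W] is the span of the [u j] with [j != i]. *)
pose W (x : U) := exists c : 'I_n -> K, c i = 0 /\ x = \sum_j c j *: u j.
have sW : subspace W.
  split=> [|k _ _ [c [ci ->]] [d [di ->]]].
    exists (fun=> 0); split=> //.
    by rewrite big1 // => j _; rewrite scale0r.
  exists (fun j => k * c j + d j); split; first by rewrite ci di mulr0 addr0.
  rewrite scaler_sumr -big_split /=; apply: eq_bigr => j _.
  by rewrite scalerA scalerDl.
have nWu : ~ W (u i).
  move=> [c [ci uE]]; suff : (n <= n.-1)%N.
    by case: n i {u v tE n_min W sW c ci uE} => [[]//|n] _; rewrite ltnn.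
  apply: n_min; apply/asboolP.
  exists (fun j => u (lift i j)), (fun j => v (lift i j) + c (lift i j) *: v i).
  rewrite tE (bigD1_ord i) //= [in LHS]uE (bigD1_ord i) //= ci scale0r add0r.
  rewrite linear_sumlz -big_split /=; apply: eq_bigr => j _.
  by rewrite addrC linearDr linearZr_LR linearZl_LR.
have [f [fi f0]] := separating_functional sW nWu.
exists f => j; have [<-|ij] := eqVneq; first exact: fi.
apply: f0; exists (fun l => (l == j)%:R); rewrite (negbTE ij); split=> //.
rewrite (bigD1 j) //= eqxx scale1r big1 ?addr0 // => l /negbTE ->.
by rewrite scale0r.
Qed.

End DualDecomposition.

(** * Finite-dimensional subspaces *)

(** The family [b] need not lie in [N], so a spanning family inside [N] has to
be made: the rows of a matrix of maximal rank among those whose row space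
consists of coordinates, relative to [b], of elements of [N]. *)
Lemma finite_dim_sub_span (K : fieldType) (V : lmodType K) (N : {pred V})
    (I : finType) (b : I -> V) :
  GRing.submod_closed N ->
  (forall x, x \in N -> exists c : I -> K, x = \sum_i c i *: b i) ->
  finite_dim N.
Proof.
move=> [N0 NP] Nb; pose n := #|I|.
pose comb (c : 'rV[K]_n) := \sum_i c 0 i *: b (enum_val i).
have comb_lin : linear comb.
  move=> k c d; rewrite /comb scaler_sumr -big_split /=.
  by apply: eq_bigr => i _; rewrite !mxE scalerDl scalerA.
pose combL : {linear 'rV[K]_n -> V} :=
  HB.pack comb (GRing.isLinear.Build _ _ _ _ _ comb_lin).
have comb0 : comb 0 = 0 := linear0 combL.
have combD c d : comb (c + d) = comb c + comb d := linearD combL c d.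
have combZ k c : comb (k *: c) = k *: comb c := linearZ_LR combL k c.
pose ok r := `[< exists B : 'M[K]_n,
  (forall c : 'rV_n, (c <= B)%MS -> comb c \in N) /\ \rank B = r >].
have ok0 : exists r, ok r.
  exists 0; apply/asboolP; exists 0; split; last exact: mxrank0.
  by move=> c; rewrite submx0 => /eqP->; rewrite comb0.
have ok_le r : ok r -> (r <= n)%N.
  by move=> /asboolP[B [_ <-]]; apply: rank_leq_row.
have [r /asboolP[B [BN rB]] r_max] := ex_maxnP ok0 ok_le.
exists n, (fun i => comb (row i B)) => x; split=> [xN|[c ->]]; last first.
  elim/big_ind: _ => // [y z yN zN|i _].
    by rewrite -[y]scale1r NP.
  by rewrite -[_ *: _]addr0 NP // BN // row_sub.
have [c xE] := Nb x xN.
pose d : 'rV[K]_n := \row_i c (enum_val i).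
have xd : x = comb d.
  rewrite xE (reindex_onto enum_val enum_rank) /= => [|i _].
    by apply: eq_big => [i|i _]; rewrite ?enum_valK ?eqxx ?mxE.
  exact: enum_rankK.
have /submxP[e dE] : (d <= B)%MS.
  (* Were [d] not in the row space of [B], adding it would increase the rank. *)
  have ok_sum : ok (\rank (B + d)%MS).
    apply/asboolP; exists (B + d)%MS; split=> // w /sub_addsmxP[[w1 w2] /= ->].
    rewrite combD addrC (mx11_scalar w2) mul_scalar_mx.
    by rewrite combZ NP -?xd // BN // submxMl.
  have := r_max _ ok_sum; rewrite -rB => le_rank.
  have /mxrank_leqif_sup[_] := addsmxSl B d.
  rewrite eqn_leq le_rank mxrankS ?addsmxSl //= => /esym.
  by rewrite addsmx_sub => /andP[].
exists (fun i => e 0 i); rewrite xd dE mulmx_sum_row [LHS](linear_sum combL).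
by apply: eq_bigr => i _; apply: combZ.
Qed.

Lemma finite_dimS (K : fieldType) (V : lmodType K) (N M : {pred V}) :
  GRing.submod_closed N -> {subset N <= M} -> finite_dim M -> finite_dim N.
Proof.
move=> subN NM [n [b bM]]; apply: (finite_dim_sub_span subN (b := b)) => x /NM.
by move/bM.
Qed.

(** * Slices of tensors *)

Lemma tensor_ext (K : fieldType) (U V W : lmodType K)
    (f g : {linear tensor U V -> W}) (t : tensor U V) :
  (forall u v, f (u \ot v) = g (u \ot v)) -> f t = g t.
Proof. by move/tensor_lift_uniq; apply. Qed.

Section TensorTools.
Variables (K : fieldType) (U V : lmodType K).

Section SliceL.
Variable f : {linear U -> K^o}.

Definition slicel_pure (u : U) (v : V) : V := (f u : K) *: v.

Lemma slicel_pure_is_bilinear : bilinear_for *:%R *:%R slicel_pure.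
Proof.
split=> [v|u] k x y; rewrite /slicel_pure.
  by rewrite linearP /= scalerDl scalerA.
by rewrite scalerDr scalerA mulrC -scalerA.
Qed.

HB.instance Definition _ := bilinear_isBilinear.Build K U V V
  *:%R *:%R slicel_pure slicel_pure_is_bilinear.

Definition slicel : tensor U V -> V := tensor_lift slicel_pure.
HB.instance Definition _ := GRing.Linear.on slicel.

Lemma slicel_pureE u v : slicel (u \ot v) = (f u : K) *: v.
Proof. exact: tensor_lift_pure. Qed.

End SliceL.

Section SliceR.
Variable f : {linear V -> K^o}.

Definition slicer_pure (u : U) (v : V) : U := (f v : K) *: u.

Lemma slicer_pure_is_bilinear : bilinear_for *:%R *:%R slicer_pure.
Proof.
split=> [v|u] k x y; rewrite /slicer_pure.
  by rewrite scalerDr scalerA mulrC -scalerA.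
by rewrite linearP /= scalerDl scalerA.
Qed.

HB.instance Definition _ := bilinear_isBilinear.Build K U V U
  *:%R *:%R slicer_pure slicer_pure_is_bilinear.

Definition slicer : tensor U V -> U := tensor_lift slicer_pure.
HB.instance Definition _ := GRing.Linear.on slicer.

Lemma slicer_pureE u v : slicer (u \ot v) = (f v : K) *: u.
Proof. exact: tensor_lift_pure. Qed.

End SliceR.

Lemma tensor_pureZl k (u : U) (v : V) : (k *: u) \ot v = k *: (u \ot v).
Proof. exact: linearZl_LR. Qed.

Lemma tensor_pureZr k (u : U) (v : V) : u \ot (k *: v) = k *: (u \ot v).
Proof. exact: linearZr_LR. Qed.

End TensorTools.

Section Counit.
Variables (K : fieldType) (C : coalgType K).

(** Slicing by the counit turns the counit axioms, which live in tensor
products with the base field, into equations in [C]. *)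
Lemma slicel_counit (x : C) : slicel counit (comul x) = x.
Proof.
rewrite (@tensor_ext _ _ _ _ (slicel counit)
  (slicel (@idfun K^o) \o tensor_map counit idfun)) /= => [|u v].
  by rewrite counitl slicel_pureE scale1r.
by rewrite tensor_map_pureE !slicel_pureE.
Qed.

Lemma slicer_counit (x : C) : slicer counit (comul x) = x.
Proof.
rewrite (@tensor_ext _ _ _ _ (slicer counit)
  (slicer (@idfun K^o) \o tensor_map idfun counit)) /= => [|u v].
  by rewrite counitr slicer_pureE scale1r.
by rewrite tensor_map_pureE !slicer_pureE.
Qed.
End Counit.

Section RightLegs.
Variable K : fieldType.

(** Tensoring over a field is exact: this decomposition exhibits the kernel of
[id (x) L] as the tensor product with the kernel of [L]. The same decomposition
serves all [L] at once, which handles intersections of kernels. *)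
Lemma right_legs (U V : lmodType K) (t : tensor U V) :
  exists s : seq (U * V), t = \sum_(p <- s) p.1 \ot p.2 /\
    forall (W : lmodType K) (L : {linear V -> W}),
      tensor_map idfun L t = 0 -> forall p, p \in s -> L p.2 = 0.
Proof.
have [n [u [v [f [tE fu]]]]] := dual_decomposition t.
exists [seq (u i, v i) | i <- enum 'I_n]; split.
  by rewrite big_map big_enum.
move=> W L Lt _ /mapP[i _ ->] /=.
have := congr1 (slicel (f i)) Lt; rewrite raddf0 tE => <-.
rewrite [tensor_map _ _ _]raddf_sum [RHS]raddf_sum /=.
rewrite (bigD1 i) //= big1 => [|j ji]; rewrite tensor_map_pureE slicel_pureE fu.
  by rewrite eqxx scale1r addr0.
by rewrite eq_sym (negbTE ji) scale0r.
Qed.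

End RightLegs.

(** * Contractions *)

Section Contraction.
Variables (K : fieldType) (A : hopfAlgType K).

(** The two instances of interest are [S u * v], and [v * T u] for [T] the
inverse of the antipode. *)
Definition contraction (h : {bilinear A -> A -> A}) : Prop :=
  forall x, tensor_lift h (comul x) = (counit x : K)%:A.

Variable h : {bilinear A -> A -> A}.

(** [contract12] applies [h] to the first two factors of a tensor associated to
the right. Currying it in the first factor replaces an inverse of
[tensor_assoc]. *)
Definition contract12_pure (u : A) (t : tensor A A) : tensor A A :=
  tensor_map (h u) idfun t.

Lemma contract12_pure_is_bilinear : bilinear_for *:%R *:%R contract12_pure.
Proof.
split=> [t|u] k x y; rewrite /contract12_pure; last exact: linearP.
have [s ->] := tensor_sumP t; rewrite [LHS]raddf_sum.
rewrite [X in _ = k *: X + _]raddf_sum [X in _ = _ + X]raddf_sum.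
rewrite scaler_sumr -big_split /=.
by apply: eq_bigr => p _; rewrite !tensor_map_pureE /= linearPl tensor_purePl.
Qed.

HB.instance Definition _ := bilinear_isBilinear.Build K A (tensor A A)
  (tensor A A) *:%R *:%R contract12_pure contract12_pure_is_bilinear.

Definition contract12 : tensor A (tensor A A) -> tensor A A :=
  tensor_lift contract12_pure.
HB.instance Definition _ := GRing.Linear.on contract12.

Lemma contract12E u t : contract12 (u \ot t) = tensor_map (h u) idfun t.
Proof. exact: tensor_lift_pure. Qed.

Hypothesis h_contr : contraction h.

Lemma contract12_comul x :
  contract12 (tensor_map idfun comul (comul x)) = 1 \ot x.
Proof.
rewrite -comulA -[in RHS](slicel_counit x).
have [s ->] := tensor_sumP (comul x).
rewrite [tensor_map comul _ _]raddf_sum [tensor_assoc _]raddf_sum.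
rewrite [LHS]raddf_sum [slicel _ _]raddf_sum linear_sumr.
apply: eq_bigr => p _.
rewrite /= tensor_map_pureE slicel_pureE tensor_pureZr -tensor_pureZl -h_contr.
have [r ->] := tensor_sumP (comul p.1).
rewrite linear_sumlz [tensor_assoc _]raddf_sum [LHS]raddf_sum.
rewrite [tensor_lift _ _]raddf_sum linear_sumlz; apply: eq_bigr => q _.
by rewrite /= tensor_assocE contract12E tensor_map_pureE tensor_lift_pure.
Qed.

Lemma contract23_comul x :
  tensor_map idfun (tensor_lift h) (tensor_map idfun comul (comul x)) = x \ot 1.
Proof.
rewrite -[in RHS](slicer_counit x).
have [s ->] := tensor_sumP (comul x).
rewrite [tensor_map _ comul _]raddf_sum [LHS]raddf_sum.
rewrite [slicer _ _]raddf_sum linear_sumlz; apply: eq_bigr => p _.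
rewrite /= !tensor_map_pureE slicer_pureE /= h_contr.
by rewrite tensor_pureZl tensor_pureZr.
Qed.

End Contraction.

Section FiniteTranslates.
Variables (K : fieldType) (A : hopfAlgType K).

Lemma functional_eq1 (U : lmodType K) (u : U) :
  u != 0 -> exists f : {linear U -> K^o}, f u = 1.
Proof.
move=> /eqP u0.
have sW : subspace [set x : U | x = 0].
  by split=> // k x y -> ->; rewrite scaler0 addr0.
by have [f [fu _]] := separating_functional sW u0; exists f.
Qed.

(** The heart of the finiteness argument. The hypotheses on [R], which will be
a multiplication by an element [x], let [R] pass from [1 = \sum_i h (b i) (p i)]
to the [p i], and from the right leg of [comul P] to its left leg. Slicing the
latter relation by the dual functionals [f i] puts [R (p i)] in the span of the
[p k], so that [R 1] is in the span of the [h (b i) (p k)], a family that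
depends on [h] and [P] alone. *)
Lemma finite_span_translates (h : {bilinear A -> A -> A}) (P : A) :
  contraction h -> P != 0 ->
  exists (I : finType) (b : I -> A), forall R R' : {linear A -> A},
    (forall u v, R (h u v) = h u (R v)) ->
    tensor_map idfun R (comul P) = tensor_map R' idfun (comul P) ->
    exists c : I -> K, R 1 = \sum_i c i *: b i.
Proof.
move=> h_contr /functional_eq1[f0 f0P].
have [n [a [p [f [DP fa]]]]] := dual_decomposition (comul P).
(* With [f0 P = 1], the sum of the [h (b i) (p i)] is
   [f0(P1) h(P2, P3) = f0(P1) e(P2) = f0 P]. *)
pose b i := slicel f0 (comul (a i)).
have unit_sum : \sum_i h (b i) (p i) = 1.
  have := congr1 (slicel f0) (contract23_comul h_contr P).
  rewrite slicel_pureE f0P scale1r -comulA DP => <-.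
  rewrite [tensor_map comul _ _]raddf_sum [tensor_assoc _]raddf_sum.
  rewrite [tensor_map _ _ _]raddf_sum [RHS]raddf_sum; apply: eq_bigr => i _ /=.
  rewrite tensor_map_pureE /b; have [s ->] := tensor_sumP (comul (a i)).
  rewrite [slicel _ _]raddf_sum 2!linear_sumlz [tensor_assoc _]raddf_sum.
  rewrite [tensor_map _ _ _]raddf_sum [RHS]raddf_sum; apply: eq_bigr => q _ /=.
  rewrite tensor_assocE tensor_map_pureE !slicel_pureE /= tensor_lift_pure.
  exact: linearZl_LR.
exists ('I_n * 'I_n)%type, (fun ik => h (b ik.1) (p ik.2)) => R R' Rh RR'.
have Rp i : R (p i) = \sum_k (f i (R' (a k)) : K) *: p k.
  have := congr1 (slicel (f i)) RR'; rewrite DP.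
  rewrite ![tensor_map _ _ _]raddf_sum ![slicel _ _]raddf_sum /=.
  rewrite (bigD1 i) //= big1 => [|j ji].
    rewrite tensor_map_pureE slicel_pureE /= fa eqxx scale1r addr0 => ->.
    by apply: eq_bigr => k _; rewrite tensor_map_pureE slicel_pureE.
  by rewrite tensor_map_pureE slicel_pureE /= fa eq_sym (negbTE ji) scale0r.
exists (fun ik => f ik.1 (R' (a ik.2))).
rewrite -unit_sum raddf_sum -(pair_bigA _ (fun i k =>
  (f i (R' (a k)) : K) *: h (b i) (p k))) /=.
apply: eq_bigr => i _; rewrite Rh Rp linear_sumr.
by apply: eq_bigr => k _; rewrite linearZr_LR.
Qed.

End FiniteTranslates.

(** * The antipode reverses products *)

Section Convolution.
Variables (K : fieldType) (A : hopfAlgType K).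

Definition conv (f g : {linear A -> A}) (x : A) : A :=
  mul_tensor (tensor_map f g (comul x)).

HB.instance Definition _ f g := GRing.Linear.copy (conv f g)
  (@mul_tensor K A \o tensor_map f g \o @comul K A).

(** The unit of the convolution product [conv]. *)
Definition counit_unit (x : A) : A := (counit x : K)%:A.

Lemma counit_unit_is_linear : linear counit_unit.
Proof. by move=> k x y; rewrite /counit_unit linearP /= scalerDl scalerA. Qed.

HB.instance Definition _ :=
  GRing.isLinear.Build K A A *:%R counit_unit counit_unit_is_linear.

Lemma conv_sum (f g : {linear A -> A}) (x : A) (s : seq (A * A)) :
  comul x = \sum_(p <- s) p.1 \ot p.2 ->
  conv f g x = \sum_(p <- s) f p.1 * g p.2.
Proof.
rewrite /conv => ->; rewrite [tensor_map _ _ _]raddf_sum [LHS]raddf_sum.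
by apply: eq_bigr => p _ /=; rewrite tensor_map_pureE mul_tensor_pure.
Qed.

Lemma eq_conv (f f' g g' : {linear A -> A}) :
  f =1 f' -> g =1 g' -> conv f g =1 conv f' g'.
Proof.
move=> ff gg x; have [s xs] := tensor_sumP (comul x).
by rewrite !(conv_sum _ _ xs); apply: eq_bigr => p _; rewrite ff gg.
Qed.

Lemma conv_counitr (f : {linear A -> A}) x : conv f counit_unit x = f x.
Proof.
have [s xs] := tensor_sumP (comul x).
rewrite (conv_sum _ _ xs) -[in RHS](slicer_counit x) xs.
rewrite [slicer _ _]raddf_sum raddf_sum; apply: eq_bigr => p _ /=.
by rewrite slicer_pureE linearZ_LR -scalerAr mulr1.
Qed.

Lemma conv_counitl (f : {linear A -> A}) x : conv counit_unit f x = f x.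
Proof.
have [s xs] := tensor_sumP (comul x).
rewrite (conv_sum _ _ xs) -[in RHS](slicel_counit x) xs.
rewrite [slicel _ _]raddf_sum raddf_sum; apply: eq_bigr => p _ /=.
by rewrite slicel_pureE linearZ_LR -scalerAl mul1r.
Qed.

Lemma convA (f g e : {linear A -> A}) x :
  conv f (conv g e) x = conv (conv f g) e x.
Proof.
pose m3 : {linear tensor A (tensor A A) -> A} :=
  @mul_tensor K A \o tensor_map f (@mul_tensor K A \o tensor_map g e).
have m3E u v w : m3 (u \ot (v \ot w)) = f u * (g v * e w).
  rewrite /= tensor_map_pureE mul_tensor_pure /=.
  by rewrite tensor_map_pureE mul_tensor_pure.
have m3E' u t : m3 (u \ot t) = f u * mul_tensor (tensor_map g e t).
  by rewrite /= tensor_map_pureE mul_tensor_pure.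
(* Generalizing over [m3] keeps it folded when sums are moved through it. *)
move: m3 m3E m3E' => m3 m3E m3E'.
transitivity (m3 (tensor_map idfun comul (comul x))).
  have [s xs] := tensor_sumP (comul x).
  rewrite (conv_sum _ _ xs) xs [tensor_map _ comul _]raddf_sum.
  rewrite [RHS]raddf_sum; apply: eq_bigr => p _ /=.
  by rewrite tensor_map_pureE m3E'.
rewrite -comulA; have [s xs] := tensor_sumP (comul x).
rewrite (conv_sum _ _ xs) xs [tensor_map comul _ _]raddf_sum.
rewrite [tensor_assoc _]raddf_sum [LHS]raddf_sum; apply: eq_bigr => p _ /=.
rewrite tensor_map_pureE; have [r pr] := tensor_sumP (comul p.1).
rewrite (conv_sum _ _ pr) pr linear_sumlz [tensor_assoc _]raddf_sum.
rewrite [LHS]raddf_sum mulr_suml; apply: eq_bigr => q _ /=.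
by rewrite tensor_assocE m3E mulrA.
Qed.

(** The antipode is a convolution inverse of the identity, so that it can be
moved to the other side of an equation. *)
Lemma conv_move_antipode (f g : {linear A -> A}) :
  conv f idfun =1 g -> f =1 conv g antipode.
Proof.
move=> fg x; rewrite -(eq_conv (f := conv f idfun) fg (fun=> erefl)) -convA.
by rewrite -[LHS]conv_counitr; apply: eq_conv => // y; rewrite [RHS]antipoder.
Qed.

Lemma antipode1 : antipode (1 : A) = 1.
Proof.
have := antipodel (1 : A); rewrite comul1 tensor_oneE tensor_map_pureE.
by rewrite mul_tensor_pure /= mulr1 counit1 scale1r.
Qed.

Section Antimultiplicative.
Variable x : A.

(** [antipode_shift y] is [S(x1 y) x2], whose value [e(x) S(y)] is an
intermediate step towards [S(x y) = S(y) S(x)]. *)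
Definition antipode_shift (y : A) : A := conv (antipode \o (y \o* idfun)) idfun x.

Lemma antipode_shift_sum (s : seq (A * A)) y :
  comul x = \sum_(p <- s) p.1 \ot p.2 ->
  antipode_shift y = \sum_(p <- s) antipode (p.1 * y) * p.2.
Proof. exact: conv_sum. Qed.

Lemma antipode_shift_is_linear : linear antipode_shift.
Proof.
have [s xs] := tensor_sumP (comul x).
move=> k y z; rewrite !(antipode_shift_sum _ xs) scaler_sumr -big_split /=.
apply: eq_bigr => p _.
by rewrite mulrDr -scalerAr linearP mulrDl -scalerAl.
Qed.

HB.instance Definition _ :=
  GRing.isLinear.Build K A A *:%R antipode_shift antipode_shift_is_linear.

(** As functions of [y], both sides give [e(x) e(y)] after convolution by the
identity: the left one by the antipode axiom for the product [x * y]. *)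
Lemma antipode_shiftE y : antipode_shift y = (counit x : K) *: antipode y.
Proof.
transitivity (conv ((counit x : K) \*: counit_unit) antipode y).
  apply: conv_move_antipode => {}y /=.
  have := antipodel (x * y); rewrite comulM counitM -scalerA => <-.
  have [s xs] := tensor_sumP (comul x); have [t yt] := tensor_sumP (comul y).
  rewrite (conv_sum _ _ yt) xs yt mulr_sumr.
  rewrite [tensor_map _ _ _]raddf_sum [RHS]raddf_sum; apply: eq_bigr => q _ /=.
  rewrite (antipode_shift_sum _ xs) !mulr_suml.
  rewrite [tensor_map _ _ _]raddf_sum [RHS]raddf_sum; apply: eq_bigr => p _ /=.
  by rewrite tensor_mulE tensor_map_pureE mul_tensor_pure mulrA.
have [t yt] := tensor_sumP (comul y).
rewrite -[antipode y]conv_counitl !(conv_sum _ _ yt) scaler_sumr.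
by apply: eq_bigr => q _ /=; rewrite scalerAl.
Qed.

End Antimultiplicative.

(** Convolve [x |-> S(x y)] by the identity: the result [S(x1 y) x2 = e(x) S(y)]
is [antipode_shiftE]. Convolving back by [S] gives [e(x1) S(y) S(x2)]. *)
Lemma antipodeM x y : antipode (x * y : A) = antipode y * antipode x.
Proof.
have /= -> := @conv_move_antipode (antipode \o (y \o* idfun))
  (antipode y \o* counit_unit) _ x.
  have [s xs] := tensor_sumP (comul x).
  rewrite -[antipode x in RHS]conv_counitl !(conv_sum _ _ xs) mulr_sumr.
  apply: eq_bigr => p _ /=.
  by rewrite -!scalerAl !mul1r scalerAr.
by move=> z; rewrite [LHS]antipode_shiftE /= -scalerAl mul1r.
Qed.

End Convolution.

Section TwistedProducts.
Variables (K : fieldType) (A : algType K) (T : {linear A -> A}).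

Definition lmul_by (u v : A) : A := T u * v.
Definition rmul_by (u v : A) : A := v * T u.

Lemma lmul_by_is_bilinear : bilinear_for *:%R *:%R lmul_by.
Proof.
by split=> [v|u] k x y; rewrite /lmul_by ?linearP ?mulrDl ?mulrDr
  -?scalerAl -?scalerAr.
Qed.

Lemma rmul_by_is_bilinear : bilinear_for *:%R *:%R rmul_by.
Proof.
by split=> [v|u] k x y; rewrite /rmul_by ?linearP ?mulrDl ?mulrDr
  -?scalerAl -?scalerAr.
Qed.

HB.instance Definition _ := bilinear_isBilinear.Build K A A A
  *:%R *:%R lmul_by lmul_by_is_bilinear.
HB.instance Definition _ := bilinear_isBilinear.Build K A A A
  *:%R *:%R rmul_by rmul_by_is_bilinear.

End TwistedProducts.

Section AntipodeContractions.
Variables (K : fieldType) (A : hopfAlgType K).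

Lemma contraction_antipode : contraction (lmul_by (antipode : {linear A -> A})).
Proof.
move=> x; rewrite -antipodel; have [s ->] := tensor_sumP (comul x).
rewrite [tensor_map _ _ _]raddf_sum [LHS]raddf_sum [RHS]raddf_sum.
apply: eq_bigr => p _ /=.
by rewrite tensor_lift_pure tensor_map_pureE mul_tensor_pure.
Qed.

(** The antipode is injective and sends [x2 * T x1] to [x1 * S x2]. *)
Lemma contraction_inv_antipode (T : {linear A -> A}) :
  cancel T antipode -> cancel antipode T -> contraction (rmul_by T).
Proof.
move=> TK KT x; apply: (can_inj KT).
rewrite linearZ_LR antipode1 -antipoder; have [s ->] := tensor_sumP (comul x).
rewrite [tensor_map _ _ _]raddf_sum [tensor_lift _ _]raddf_sum.
rewrite [LHS]raddf_sum [RHS]raddf_sum; apply: eq_bigr => p _ /=.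
by rewrite tensor_lift_pure tensor_map_pureE mul_tensor_pure /= antipodeM TK.
Qed.

End AntipodeContractions.

(** * Left coideal subalgebras *)

Section Coideals.
Variables (K : fieldType) (A : hopfAlgType K).

Section Defect.
Variables (m : {linear A -> A}) (P : A).

(** With [m] the left, respectively right, multiplication by [P], the kernel of
[defect] is [Nl P], respectively [Nr P]. *)
Definition defect (x : A) : tensor A A :=
  tensor_map idfun m (comul x) - x \ot P.

Lemma defect_is_linear : linear defect.
Proof.
move=> k x y; rewrite /defect !linearP tensor_purePl scalerBr.
by rewrite opprD addrACA.
Qed.

HB.instance Definition _ :=
  GRing.isLinear.Build K A (tensor A A) *:%R defect defect_is_linear.

(** Apply [comul] to the left leg of the equation [x1 (x) m x2 = x (x) P];
coassociativity turns the left side into [x1 (x) (x2 (x) m x3)]. *)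
Lemma defect_coideal x : defect x = 0 -> tensor_map idfun defect (comul x) = 0.
Proof.
move=> /eqP; rewrite subr_eq0 => /eqP xP.
transitivity (tensor_map idfun (tensor_map idfun m)
    (tensor_map idfun comul (comul x)) - tensor_assoc (comul x \ot P)).
  have [s ->] := tensor_sumP (comul x); rewrite linear_sumlz.
  rewrite [tensor_map _ comul _]raddf_sum.
  rewrite [tensor_map _ (tensor_map _ _) _]raddf_sum.
  rewrite [tensor_assoc _]raddf_sum -sumrB [LHS]raddf_sum.
  apply: eq_bigr => p _ /=; rewrite !tensor_map_pureE tensor_assocE /=.
  by rewrite linearBr.
rewrite -comulA -(tensor_map_pureE comul idfun) -xP; apply/eqP.
rewrite subr_eq0; apply/eqP.
apply: (@tensor_ext K A A (tensor A (tensor A A))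
  (tensor_map idfun (tensor_map idfun m) \o @tensor_assoc K A A A
     \o tensor_map (@comul K A) idfun)
  (@tensor_assoc K A A A \o tensor_map (@comul K A) idfun
     \o tensor_map idfun m)) => u v /=.
rewrite !tensor_map_pureE /=; have [r ->] := tensor_sumP (comul u).
rewrite !linear_sumlz ![tensor_assoc _]raddf_sum [LHS]raddf_sum.
apply: eq_bigr => q _ /=.
by rewrite !tensor_assocE tensor_map_pureE /= tensor_map_pureE.
Qed.

End Defect.

Lemma mul_1ot_l (P : A) (t : tensor A A) :
  (1 \ot P) * t = tensor_map idfun (P \*o idfun) t.
Proof.
have [s ->] := tensor_sumP t; rewrite mulr_sumr [RHS]raddf_sum.
by apply: eq_bigr => p _ /=; rewrite tensor_mulE mul1r tensor_map_pureE.
Qed.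

Lemma mul_1ot_r (P : A) (t : tensor A A) :
  t * (1 \ot P) = tensor_map idfun (P \o* idfun) t.
Proof.
have [s ->] := tensor_sumP t; rewrite mulr_suml [RHS]raddf_sum.
by apply: eq_bigr => p _ /=; rewrite tensor_mulE mulr1 tensor_map_pureE.
Qed.

Lemma NlP (P x : A) : reflect (defect (P \*o idfun) P x = 0) (x \in Nl P).
Proof. by rewrite inE mul_1ot_l -subr_eq0; apply: eqP. Qed.

Lemma NrP (P x : A) : reflect (defect (P \o* idfun) P x = 0) (x \in Nr P).
Proof. by rewrite inE mul_1ot_r -subr_eq0; apply: eqP. Qed.

Lemma Nl_subalg (P : A) : GRing.subalg_closed (Nl P).
Proof.
split=> [|k x y /NlP xN /NlP yN|x y]; first by rewrite inE comul1 mulr1.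
  by apply/NlP; rewrite linearP /= xN yN scaler0 addr0.
rewrite !inE comulM mulrA => /eqP-> /eqP yN.
rewrite (_ : x \ot P = (x \ot 1) * (1 \ot P)); last first.
  by rewrite tensor_mulE mulr1 mul1r.
by rewrite -mulrA yN tensor_mulE mul1r.
Qed.

Lemma Nr_subalg (P : A) : GRing.subalg_closed (Nr P).
Proof.
split=> [|k x y /NrP xN /NrP yN|x y]; first by rewrite inE comul1 mul1r.
  by apply/NrP; rewrite linearP /= xN yN scaler0 addr0.
rewrite !inE comulM -mulrA => /eqP xN /eqP->.
rewrite (_ : y \ot P = (1 \ot P) * (y \ot 1)); last first.
  by rewrite tensor_mulE mulr1 mul1r.
by rewrite mulrA xN tensor_mulE mulr1.
Qed.

Lemma Nl_coideal (P : A) : left_coideal_subalgebra (Nl P).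
Proof.
split=> [|x /NlP xN]; first exact: Nl_subalg.
have [s [sE sP]] := right_legs (comul x); exists s; split=> // p ps.
apply/NlP; exact: (sP _ (defect (P \*o idfun) P) (defect_coideal xN) p ps).
Qed.

Lemma Nr_coideal (P : A) : left_coideal_subalgebra (Nr P).
Proof.
split=> [|x /NrP xN]; first exact: Nr_subalg.
have [s [sE sP]] := right_legs (comul x); exists s; split=> // p ps.
apply/NrP; exact: (sP _ (defect (P \o* idfun) P) (defect_coideal xN) p ps).
Qed.

Lemma Nlr_coideal (P : A) : left_coideal_subalgebra (Nlr P).
Proof.
split=> [|x /andP[/NlP xl /NrP xr]].
  have [l1 lP lM] := Nl_subalg P; have [r1 rP rM] := Nr_subalg P.
  split=> [|k x y /andP[xl xr] /andP[yl yr]|x y /andP[xl xr] /andP[yl yr]];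
    apply/andP; split; by [|apply: lP|apply: rP|apply: lM|apply: rM].
have [s [sE sP]] := right_legs (comul x); exists s; split=> // p ps.
by apply/andP; split; [apply/NlP|apply/NrP];
  [apply: (sP _ (defect (P \*o idfun) P) (defect_coideal xl))
  |apply: (sP _ (defect (P \o* idfun) P) (defect_coideal xr))].
Qed.

End Coideals.

(** * Finite dimension *)

Section FiniteDimension.
Variables (K : fieldType) (A : hopfAlgType K).

(** The image of [x1 (x) P x2 = x (x) P] under
[u (x) v |-> comul v * (T u (x) 1)]: on the left, [comul P] factors out and
[comul x2 * (T x1 (x) 1)] collapses to [1 (x) x]. *)
Lemma Nl_slide (T : {linear A -> A}) (P x : A) : contraction (rmul_by T) ->
  x \in Nl P ->
  tensor_map idfun (x \o* idfun) (comul P) =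
  tensor_map ((rmul_by T : {bilinear A -> A -> A}) x) idfun (comul P).
Proof.
move=> cT; rewrite inE mul_1ot_l => /eqP xP.
have mapM (u : A) (s t : tensor A A) :
    tensor_map ((rmul_by T : {bilinear A -> A -> A}) u) idfun (s * t) =
    s * tensor_map ((rmul_by T : {bilinear A -> A -> A}) u) idfun t.
  have [r1 ->] := tensor_sumP s; have [r2 ->] := tensor_sumP t.
  rewrite !mulr_suml [LHS]raddf_sum; apply: eq_bigr => p _ /=.
  rewrite mulr_sumr ![tensor_map _ _ _]raddf_sum mulr_sumr.
  apply: eq_bigr => q _ /=; rewrite tensor_mulE !tensor_map_pureE tensor_mulE.
  by rewrite /= /rmul_by mulrA.
have keyM (t : tensor A A) : contract12 (rmul_by T)
      (tensor_map idfun comul (tensor_map idfun (P \*o idfun) t)) =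
    comul P * contract12 (rmul_by T) (tensor_map idfun comul t).
  have [s ->] := tensor_sumP t.
  elim: s => [|p s IHs]; first by rewrite big_nil !linear0 mulr0.
  rewrite big_cons !linearD /= mulrDr IHs; congr (_ + _).
  by rewrite !tensor_map_pureE !contract12E /= comulM mapM.
rewrite -contract12E -(tensor_map_pureE idfun comul) -xP -mul_1ot_r.
by rewrite -(contract12_comul cT) keyM.
Qed.

(** The mirror image, under [u (x) v |-> (T u (x) 1) * comul v]. *)
Lemma Nr_slide (T : {linear A -> A}) (P x : A) : contraction (lmul_by T) ->
  x \in Nr P ->
  tensor_map idfun (x \*o idfun) (comul P) =
  tensor_map ((lmul_by T : {bilinear A -> A -> A}) x) idfun (comul P).
Proof.
move=> cT; rewrite inE mul_1ot_r => /eqP xP.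
have mapM (u : A) (s t : tensor A A) :
    tensor_map ((lmul_by T : {bilinear A -> A -> A}) u) idfun (s * t) =
    tensor_map ((lmul_by T : {bilinear A -> A -> A}) u) idfun s * t.
  have [r1 ->] := tensor_sumP s; have [r2 ->] := tensor_sumP t.
  rewrite mulr_suml [LHS]raddf_sum [X in _ = X * _]raddf_sum [RHS]mulr_suml.
  apply: eq_bigr => p _ /=.
  rewrite !mulr_sumr [LHS]raddf_sum.
  apply: eq_bigr => q _ /=; rewrite tensor_mulE !tensor_map_pureE tensor_mulE.
  by rewrite /= /lmul_by mulrA.
have keyM (t : tensor A A) : contract12 (lmul_by T)
      (tensor_map idfun comul (tensor_map idfun (P \o* idfun) t)) =
    contract12 (lmul_by T) (tensor_map idfun comul t) * comul P.
  have [s ->] := tensor_sumP t.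
  elim: s => [|p s IHs]; first by rewrite big_nil !linear0 mul0r.
  rewrite big_cons !linearD /= mulrDl IHs; congr (_ + _).
  by rewrite !tensor_map_pureE !contract12E /= comulM mapM.
rewrite -contract12E -(tensor_map_pureE idfun comul) -xP -mul_1ot_l.
by rewrite -(contract12_comul cT) keyM.
Qed.

Lemma Nl_finite_dim (T : {linear A -> A}) (P : A) :
  contraction (rmul_by T) -> P != 0 -> finite_dim (Nl P).
Proof.
move=> cT P0.
have [I [b bP]] := finite_span_translates (@contraction_antipode K A) P0.
apply: (@finite_dim_sub_span _ _ _ I b) => [|x xN].
  exact: GRing.subalg_closedZ (Nl_subalg P).
have [|//|c xE] := bP (x \o* idfun) ((rmul_by T : {bilinear A -> A -> A}) x).
  by move=> u v; rewrite /= /lmul_by mulrA.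
  exact: Nl_slide.
by exists c; rewrite -xE /= mul1r.
Qed.

Lemma Nr_finite_dim (T : {linear A -> A}) (P : A) :
  contraction (rmul_by T) -> P != 0 -> finite_dim (Nr P).
Proof.
move=> cT P0; have [I [b bP]] := finite_span_translates cT P0.
apply: (@finite_dim_sub_span _ _ _ I b) => [|x xN].
  exact: GRing.subalg_closedZ (Nr_subalg P).
have [|//|c xE] := bP (x \*o idfun)
  ((lmul_by (antipode : {linear A -> A}) : {bilinear A -> A -> A}) x).
  by move=> u v; rewrite /= /rmul_by mulrA.
  exact: Nr_slide (@contraction_antipode K A) xN.
by exists c; rewrite -xE /= mulr1.
Qed.

End FiniteDimension.

Theorem corollary3p15 (K : fieldType) (A : hopfAlgType K)
    (antipode_bij : bijective (antipode : A -> A))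
    (P : A) (hP : right_grouplike_projection P) :
  (left_coideal_subalgebra (Nlr P) /\ finite_dim (Nlr P)) /\
  (left_coideal_subalgebra (Nl P) /\ finite_dim (Nl P)) /\
  (left_coideal_subalgebra (Nr P) /\ finite_dim (Nr P)).
Proof.
have [P0 _ _ _] := hP; have [T KT TK] := antipode_bij.
pose TL : {linear A -> A} :=
  HB.pack T (GRing.isLinear.Build _ _ _ _ _ (can2_linear KT TK)).
have cT : contraction (rmul_by TL) by apply: contraction_inv_antipode.
have fdl := Nl_finite_dim cT P0; have fdr := Nr_finite_dim cT P0.
have cosub := Nlr_coideal P.
split; [split=> //|split; split=> //]; last 2 first.
- exact: Nl_coideal.
- exact: Nr_coideal.
apply: finite_dimS fdl => [|x /andP[]//].
exact: GRing.subalg_closedZ cosub.1.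
Qed.
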